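(* Every infinite-dimensional uniform algebra has the strong diameter 2 property.
   Context: A uniform algebra is a closed subalgebra of $C(K)$ (complex-valued continuous functions on a compact Hausdorff space $K$, with the supremum norm) that contains the constant functions and separates the points of $K$; it is regarded here as a real Banach space. For a real Banach space $X$ with closed unit ball $B_X$ and dual unit sphere $S_{X^*}$ (of real-linear functionals), a slice of $B_X$ is a set $S(x^*,\varepsilon)=\{x\in B_X: x^*(x)>1-\varepsilon\}$ with $x^*\in S_{X^*}$, $\varepsilon>0$. A finite convex combination of slices is a set $\sum_{i=1}^n\lambda_iS(x_i^*,\varepsilon_i)=\{\sum_{i=1}^n\lambda_ix_i: x_i\in S(x_i^*,\varepsilon_i)\}$ with $n\ge1$, $\lambda_i\ge0$, $\sum_{i=1}^n\lambda_i=1$, $x_i^*\in S_{X^*}$, $\varepsilon_i>0$. $X$ has the strong diameter 2 property if every finite convex combination of slices of $B_X$ has diameter 2. *)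

(* Defs.v *)
From HB Require Import structures.
From mathcomp Require Import all_boot all_order all_algebra.
From mathcomp Require Import complex.
From mathcomp Require Import all_classical all_reals all_analysis.
Set Implicit Arguments. Unset Strict Implicit. Unset Printing Implicit Defensive.
Import Order.TTheory GRing.Theory Num.Theory.
Import numFieldNormedType.Exports.
Local Open Scope classical_set_scope.
Local Open Scope ring_scope.

(* [Rcomplex R] is the field [R[i]] of complex numbers carrying its real
   vector space structure; its library norm is the modulus, with values in [R]
   (whereas the norm of [R[i]] takes its values in [R[i]]). *)
Section RcomplexNormed.
Variable R : realType.

HB.instance Definition _ :=
  PseudoMetric.copy (Rcomplex R) (pseudoMetric_normed (Rcomplex R)).
HB.instance Definition _ := isPointed.Build (Rcomplex R) 0.
HB.instance Definition _ :=
  NormedZmod_PseudoMetric_eq.Build R (Rcomplex R) erefl.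

Lemma Rcomplex_normE (z : Rcomplex R) : `|z| = ComplexField.Normc.normc z.
Proof. by []. Qed.

Lemma Rcomplex_normM (z w : Rcomplex R) : `|(z * w : Rcomplex R)| = `|z| * `|w|.
Proof. exact: ComplexField.Normc.normcM. Qed.

Lemma Rcomplex_normZ (a : R) (z : Rcomplex R) : `|a *: z| = `|a| * `|z|.
Proof.
case: z => x y; rewrite !Rcomplex_normE /ComplexField.Normc.normc /=.
by rewrite !exprMn -mulrDr sqrtrM ?sqr_ge0// sqrtr_sqr.
Qed.

Lemma Rcomplex_scale_mul (a : R) (z : Rcomplex R) :
  a *: z = a%:C%C * z :> Rcomplex R.
Proof.
by case: z => u v; apply/eqP; rewrite eq_complex /= !mul0r subr0 addr0 !eqxx.
Qed.

HB.instance Definition _ :=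
  PseudoMetricNormedZmod_Lmodule_isNormedModule.Build R (Rcomplex R)
    Rcomplex_normZ.

End RcomplexNormed.

Definition continuous_fun (R : realType) (K : topologicalType) :
  {pred (K -> Rcomplex R)} := [pred f | `[< continuous f >]].

Arguments continuous_fun : clear implicits.

Section ContinuousFun.
Variables (R : realType) (K : topologicalType).
Implicit Types f g : K -> Rcomplex R.

Lemma continuous_funP f : reflect (continuous f) (f \in continuous_fun R K).
Proof. exact: asboolP. Qed.

Lemma Rcomplex_mul_continuous f g :
  continuous f -> continuous g -> continuous (f * g).
Proof.
move=> cf cg x; apply/cvgrPdist_lt => e e0.
set M := `|g x| + 1; set N := `|f x| + 1.
have M0 : 0 < M by rewrite ltr_wpDl.
have N0 : 0 < N by rewrite ltr_wpDl.
have /cvgrPdist_lt fx := cf x; have /cvgrPdist_lt gx := cg x.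
near=> y.
have hf : `|f x - f y| < e / 2 / M.
  by near: y; apply: fx; rewrite !divr_gt0.
have hg : `|g x - g y| < e / 2 / N.
  by near: y; apply: gx; rewrite !divr_gt0.
have hN : `|f y| <= N.
  have h1 : `|f x - f y| < 1 by near: y; apply: fx.
  rewrite -[f y](subKr (f x)) (le_trans (ler_normB _ _))// lerD2l.
  exact: ltW.
have -> : (f * g) x - (f * g) y
    = (f x - f y) * g x + f y * (g x - g y) :> Rcomplex R.
  by rewrite mulrBl mulrBr addrA subrK.
rewrite (le_lt_trans (ler_normD _ _))//.
have -> : `|(f x - f y) * g x : Rcomplex R| = `|f x - f y| * `|g x|.
  exact: Rcomplex_normM.
have -> : `|f y * (g x - g y) : Rcomplex R| = `|f y| * `|g x - g y|.
  exact: Rcomplex_normM.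
rewrite [e]splitr ltr_leD//.
  rewrite (@le_lt_trans _ _ (`|f x - f y| * M))//.
    by rewrite ler_wpM2l// lerDl.
  by rewrite -ltr_pdivlMr.
by rewrite (le_trans (ler_wpM2r _ hN))// mulrC -ler_pdivlMr// ltW.
Unshelve. all: by end_near. Qed.

Lemma continuous_fun_subring : subring_closed (continuous_fun R K).
Proof.
split=> [|f g /continuous_funP cf /continuous_funP cg|
          f g /continuous_funP cf /continuous_funP cg]; apply/continuous_funP.
- by move=> x; exact: cvg_cst.
- by move=> x; apply: cvgB; [exact: cf|exact: cg].
- exact: Rcomplex_mul_continuous.
Qed.

Lemma continuous_fun_submod : submod_closed (continuous_fun R K).
Proof.
split=> [|a f g /continuous_funP cf /continuous_funP cg]; apply/continuous_funP.
  by move=> x; exact: cvg_cst.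
by move=> x; apply: cvgD; [apply: cvgZr; exact: cf|exact: cg].
Qed.

HB.instance Definition _ :=
  GRing.isSubringClosed.Build _ (continuous_fun R K) continuous_fun_subring.
HB.instance Definition _ :=
  GRing.isSubmodClosed.Build _ _ (continuous_fun R K) continuous_fun_submod.

End ContinuousFun.

(* The space C(K) for a compact space K. Compactness is a parameter of the type
   because the supremum norm is a norm only on bounded functions. *)
Record contspace (R : realType) (K : topologicalType)
    (cK : compact [set: K]) := ContSpace {
  contspace_val :> K -> Rcomplex R ;
  contspace_valP : contspace_val \in continuous_fun R K }.

Section ContSpace.
Variables (R : realType) (K : topologicalType) (cK : compact [set: K]).
Local Notation CK := (contspace R cK).
Implicit Types f g : CK.

HB.instance Definition _ := [isSub for @contspace_val R K cK].
HB.instance Definition _ := [Choice of CK by <:].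
HB.instance Definition _ := 
  GRing.SubChoice_isSubComPzRing.Build _ _ CK (@continuous_fun_subring R K).
HB.instance Definition _ := [SubZmodule_isSubLmodule of CK by <:].

Lemma contspace_continuous f : continuous f.
Proof. exact/continuous_funP/contspace_valP. Qed.

Definition supnorm f : R := sup [set `|f x| | x in [set: K]].

Lemma contspace_bounded f : has_ubound [set `|f x| | x in [set: K]].
Proof.
have /compact_bounded[M [_ hM]] : compact (f @` [set: K]).
  apply: continuous_compact cK.
  by apply: continuous_subspaceT; exact: contspace_continuous.
exists (M + 1) => _ [x _ <-]; apply: (hM (M + 1)); first by rewrite ltrDl.
by exists x.
Qed.

Lemma le_supnorm f x : `|f x| <= supnorm f.
Proof. by apply: ub_le_sup; [exact: contspace_bounded|exists x]. Qed.

Lemma supnorm_le f (c : R) :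
  0 <= c -> (forall x, `|f x| <= c) -> supnorm f <= c.
Proof.
move=> c0 fc; have [K0|/set0P/negP/negPn/eqP E] :=
  pselect ([set `|f x| | x in [set: K]] !=set0).
  by apply: ge_sup => // _ [x _ <-].
by rewrite /supnorm E sup0.
Qed.

Lemma supnorm_ge0 f : 0 <= supnorm f.
Proof.
have [[x _]|/set0P/negP/negPn/eqP E] := pselect ([set: K] !=set0).
  by apply: (le_trans _ (le_supnorm f x)).
by rewrite /supnorm E image_set0 sup0.
Qed.

Lemma supnormD f g : supnorm (f + g) <= supnorm f + supnorm g.
Proof.
apply: supnorm_le => [|x]; first by rewrite addr_ge0 ?supnorm_ge0.
by rewrite (le_trans (ler_normD _ _))// lerD// le_supnorm.
Qed.

Lemma supnormZ (a : R) f : supnorm (a *: f) = `|a| * supnorm f.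
Proof.
have le_supnormZ (b : R) (h : CK) : supnorm (b *: h) <= `|b| * supnorm h.
  apply: supnorm_le => [|x]; first by rewrite mulr_ge0 ?supnorm_ge0.
  by rewrite normrZ ler_wpM2l// le_supnorm.
apply/eqP; rewrite eq_le le_supnormZ /=; have [->|a0] := eqVneq a 0.
  by rewrite normr0 mul0r supnorm_ge0.
have na0 : 0 < `|a| by rewrite normr_gt0.
rewrite mulrC -ler_pdivlMr// -{1}[f](scalerK a0).
by rewrite (le_trans (le_supnormZ _ _))// normfV mulrC.
Qed.

Lemma supnorm_eq0 f : supnorm f = 0 -> f = 0.
Proof.
move=> f0; apply/val_inj/funext => x; apply/eqP; rewrite -normr_eq0.
by rewrite eq_le normr_ge0 andbT -f0; exact: (le_supnorm f x).
Qed.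

HB.instance Definition _ :=
  Lmodule_isNormed.Build R CK supnormD supnormZ supnorm_eq0.

Lemma contspace_normE f : `|f| = sup [set `|f x| | x in [set: K]].
Proof. by []. Qed.

Lemma contcst_subproof (z : Rcomplex R) : cst z \in continuous_fun R K.
Proof. by apply/continuous_funP => x; exact: cvg_cst. Qed.

Definition contcst (z : Rcomplex R) : CK := ContSpace cK (contcst_subproof z).

End ContSpace.
Arguments contcst {R K} cK z.

(* [contcst cK z * f] is the complex scalar multiple z f; closure under the
   complex scalars thus follows from [unif_cst] and [unif_mul], and closure
   under opposites from [contcst cK (-1)]. *)
Record uniform_algebra (R : realType) (K : topologicalType)
    (cK : compact [set: K]) (A : set (contspace R cK)) : Prop := {
  unif_cst : forall z, A (contcst cK z) ;
  unif_add : forall f g, A f -> A g -> A (f + g) ;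
  unif_mul : forall f g, A f -> A g -> A (f * g) ;
  unif_closed : closed A ;
  unif_separates : forall x y : K, x <> y -> exists2 f, A f & f x <> f y }.

(* A uniform algebra as a real normed space of its own, with the norm of C(K). *)
Definition unif_pred (R : realType) (K : topologicalType)
    (cK : compact [set: K]) (A : set (contspace R cK))
    (uA : uniform_algebra A) : {pred contspace R cK} := [pred f | f \in A].

Record unif_space (R : realType) (K : topologicalType)
    (cK : compact [set: K]) (A : set (contspace R cK))
    (uA : uniform_algebra A) := UnifSpace {
  unif_val :> contspace R cK ;
  unif_valP : unif_val \in unif_pred uA }.

Section UnifSpace.
Variables (R : realType) (K : topologicalType) (cK : compact [set: K]).
Variables (A : set (contspace R cK)) (uA : uniform_algebra A).
Local Notation X := (unif_space uA).

Lemma unif_submod : submod_closed (unif_pred uA).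
Proof.
have aA z f : A f -> A (contcst cK z * f).
  by apply: unif_mul => //; exact: unif_cst.
split=> [|a f g]; rewrite !inE.
  rewrite (_ : 0 = contcst cK 0); first exact: unif_cst.
  exact/val_inj.
move=> Af Ag; apply: unif_add => //.
rewrite (_ : a *: f = contcst cK (a%:C)%C * f); first exact: aA.
apply/val_inj/funext => x; rewrite [LHS](Rcomplex_scale_mul a (f x)).
by [].
Qed.

HB.instance Definition _ :=
  GRing.isSubmodClosed.Build R (contspace R cK) (unif_pred uA) unif_submod.
HB.instance Definition _ := [isSub for @unif_val R K cK A uA].
HB.instance Definition _ := [Choice of X by <:].
HB.instance Definition _ := [SubChoice_isSubZmodule of X by <:].
HB.instance Definition _ := [SubZmodule_isSubLmodule of X by <:].

Definition unif_norm (f : X) : R := `|unif_val f|.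

Lemma unif_normD f g : unif_norm (f + g) <= unif_norm f + unif_norm g.
Proof. exact: ler_normD. Qed.

Lemma unif_normZ (a : R) f : unif_norm (a *: f) = `|a| * unif_norm f.
Proof. exact: normrZ. Qed.

Lemma unif_norm_eq0 f : unif_norm f = 0 -> f = 0.
Proof. by move=> f0; apply/val_inj; apply: normr0_eq0. Qed.

HB.instance Definition _ :=
  Lmodule_isNormed.Build R X unif_normD unif_normZ unif_norm_eq0.

Lemma unif_normE (f : X) : `|f| = `|unif_val f|.
Proof. by []. Qed.

End UnifSpace.

Section StrongDiameterTwo.
Variables (R : realType) (X : normedModType R).

Definition unit_ball : set X := [set x | `|x| <= 1].

Definition dual_norm (f : X -> R) : \bar R :=
  ereal_sup [set (`|f x|)%:E | x in unit_ball].

Definition dual_sphere (f : {linear X -> R}) : Prop :=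
  continuous f /\ dual_norm f = 1%:E.

Definition slice (f : X -> R) (e : R) : set X :=
  [set x | unit_ball x /\ 1 - e < f x].

Definition convex_comb (n : nat) (lam : 'I_n -> R) (S : 'I_n -> set X) :
    set X :=
  [set z | exists2 x : 'I_n -> X,
    (forall i, S i (x i)) & z = \sum_i lam i *: x i].

Definition diameter (D : set X) : \bar R :=
  ereal_sup [set (`|x - y|)%:E | x in D & y in D].

Definition strong_diameter2 : Prop :=
  forall (n : nat) (lam eps : 'I_n -> R) (f : 'I_n -> {linear X -> R}),
    (0 < n)%N ->
    (forall i, 0 <= lam i) -> \sum_i lam i = 1 ->
    (forall i, dual_sphere (f i)) -> (forall i, 0 < eps i) ->
    diameter (convex_comb lam (fun i => slice (f i) (eps i))) = 2%:E.

Definition finite_dimensional : Prop :=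
  exists (n : nat) (b : 'I_n -> X),
    forall x, exists c : 'I_n -> R, x = \sum_i c i *: b i.

End StrongDiameterTwo.

(* Main.v *)
From HB Require Import structures.
Require Import Defs.
From mathcomp Require Import all_boot all_order all_algebra.
From mathcomp Require Import all_classical all_reals all_analysis.
From mathcomp Require Import complex lra.
Set Implicit Arguments. Unset Strict Implicit. Unset Printing Implicit Defensive.
Import Order.TTheory GRing.Theory Num.Theory.
Import numFieldNormedType.Exports.
Local Open Scope classical_set_scope.
Local Open Scope ring_scope.

(* If A is infinite-dimensional, it has arbitrarily many pairwise disjoint peak
   sets, hence for each N and e functions u_1, ..., u_N in A that take the value
   1, have values close to the real segment [0, 1] (|u_k| + |1 - u_k| <= 1 + e)
   and almost disjoint supports (sum_k |u_k| <= 1 + e). The last bound gives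
   sum_k |phi (t u_k)| <= (1 + e) |t| for each functional phi of norm at most 1,
   so for N large some u = u_k is such that phi_i (t u) is negligible for the
   finitely many phi_i and t in play. If g_i lies in the i-th slice, then so do
   h_i^s = (g_i + (s - g_i) u) / (1 + e) for s = 1 and s = -1, and h_i^s has the
   value s / (1 + e) wherever u is 1; hence the convex combinations of the h_i^1
   and of the h_i^-1 are at distance at least 2 / (1 + e). *)

(** * Powers in the disc with diameter [0, 1] *)

Section ComplexPowers.
Variable R : realType.
Implicit Types z w : Rcomplex R.
Local Notation cn z := (`|(z : Rcomplex R)|).

Lemma Rcomplex_norm1 : cn 1 = 1.
Proof. by rewrite Rcomplex_normE /= expr0n expr1n addr0 sqrtr1. Qed.

Lemma Rcomplex_normX w m : cn (w ^+ m) = cn w ^+ m.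
Proof.
elim: m => [|m IH]; first by rewrite !expr0 Rcomplex_norm1.
by rewrite !exprS Rcomplex_normM IH.
Qed.

Lemma Rcomplex_normV z : cn (z^-1) = (cn z)^-1.
Proof.
have [->|z0] := eqVneq z 0.
  have -> : (0 : Rcomplex R)^-1 = 0 by exact: invr0.
  by rewrite !normr0 invr0.
have := Rcomplex_normM z (z^-1).
have -> : z * z^-1 = 1 by apply: mulfV.
rewrite Rcomplex_norm1 => h; apply: (@mulfI _ (cn z)); rewrite ?normr_eq0//.
by rewrite -h mulfV// normr_eq0.
Qed.

Lemma Rcomplex_sqnorm z :
  cn z ^+ 2 = complex.Re z ^+ 2 + complex.Im z ^+ 2.
Proof.
by case: z => a b; rewrite Rcomplex_normE /= sqr_sqrtr// addr_ge0 ?sqr_ge0.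
Qed.

(** The condition [|w|^2 + |1 - w|^2 <= 1] describes the closed disc with diameter [0, 1] (Thales),
    and [z -> (1 + z) / 2] maps the unit disc onto it. *)
Lemma half_one_add_bound z : cn z <= 1 ->
  cn (2^-1 *: (1 + z)) ^+ 2 + cn (1 - 2^-1 *: (1 + z)) ^+ 2 <= 1.
Proof.
move=> z1; have : cn z ^+ 2 <= 1 by rewrite expr_le1.
case: z {z1} => a b /=; rewrite !Rcomplex_sqnorm /=; lra.
Qed.

Lemma norm_one_sub_half z : cn (1 - 2^-1 *: (1 + z)) = 2^-1 * cn (1 - z).
Proof.
have -> : 1 - 2^-1 *: (1 + z) = 2^-1 *: (1 - z).
  case: z => a b; apply/eqP; rewrite eq_complex /=.
  by apply/andP; split; apply/eqP; lra.
by rewrite normrZ gtr0_norm// invr_gt0.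
Qed.

Lemma norm_one_sub_exp w m : cn w <= 1 -> cn (1 - w ^+ m) <= m%:R * cn (1 - w).
Proof.
move=> w1; elim: m => [|m IH]; first by rewrite expr0 subrr normr0 mul0r.
have -> : 1 - w ^+ m.+1 = (1 - w) + w * (1 - w ^+ m).
  by rewrite mulrBr mulr1 -exprS addrA subrK.
rewrite -natr1 mulrDl mul1r addrC (le_trans (ler_normD _ _))// lerD//.
rewrite Rcomplex_normM (le_trans _ IH)// ler_piMl//.
Qed.

Lemma norm_le1_of_sqr w : cn w ^+ 2 + cn (1 - w) ^+ 2 <= 1 -> cn w <= 1.
Proof.
move=> h; rewrite -(@expr_le1 _ 2)//.
by rewrite (le_trans _ h)// lerDl exprn_ge0.
Qed.

Lemma exp_lower_bound (a : R) l : 0 <= a -> 1 + l%:R * a <= (1 + a) ^+ l.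
Proof.
move=> a0; elim: l => [|l IH]; first by rewrite expr0 mul0r addr0.
rewrite exprS (le_trans _ (ler_wpM2l _ IH)) ?addr_ge0//.
rewrite -natr1; have : 0 <= l%:R * (a * a) by rewrite !mulr_ge0.
nra.
Qed.

(** In this disc, [d <= |1 - w|] gives [|w|^2 <= 1 - d^2], hence [|w|^2 (1 + d^2) <= 1]. By
    Bernoulli's inequality [|w|^(2 l) (1 + l d^2) <= 1], and [l] is chosen with [e l d^2 >= 1],
    independently of [w]. *)
Lemma exp_small_away_one (d e : R) : 0 < d -> 0 < e -> exists m0 : nat,
  forall m w, (m0 <= m)%N -> cn w ^+ 2 + cn (1 - w) ^+ 2 <= 1 ->
  d <= cn (1 - w) -> cn (w ^+ m) <= e.
Proof.
move=> d0 e0; have d20 : 0 < d ^+ 2 by rewrite exprn_gt0.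
pose l := (Num.trunc (e * d ^+ 2)^-1).+1.
exists (2 * l)%N => m w ml h dw; have w1 := norm_le1_of_sqr h.
rewrite Rcomplex_normX; apply: le_trans (_ : cn w ^+ (2 * l) <= e).
  by rewrite ler_wiXn2l.
have el : 1 <= e * (l%:R * d ^+ 2).
  rewrite mulrCA mulrC -ler_pdivrMl ?mulr_gt0// mulr1.
  by rewrite ltW// -truncn_lt_nat// invr_ge0 mulr_ge0// ltW.
have w2 : cn w ^+ 2 * (1 + d ^+ 2) <= 1.
  have dd : d ^+ 2 <= cn (1 - w) ^+ 2.
    by rewrite ler_pXn2r ?nnegrE ?normr_ge0 ?(ltW d0).
  have := exprn_ge0 2 (normr_ge0 w).
  have : cn w ^+ 2 <= 1 by rewrite expr_le1.
  nra.
have wl : cn w ^+ (2 * l) * (1 + d ^+ 2) ^+ l <= 1.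
  by rewrite exprM -exprMn exprn_ile1// mulr_ge0 ?exprn_ge0// addr_ge0// ltW.
have := exp_lower_bound l (ltW d20).
have : 0 <= cn w ^+ (2 * l) by rewrite exprn_ge0.
move: wl el; set x := cn w ^+ _; set y := (_ ^+ l); set t := l%:R * _.
move=> wl el x0 yt.
have : x * (1 + t) <= 1 by apply: le_trans wl; rewrite ler_wpM2l.
nra.
Qed.

(* At a given [w] the powers with small exponents are close to 1 and those with
   large exponents close to 0. If the exponents grow fast enough, at most one of
   them is neither; it costs at most 3 instead of [1 + 2 e]. *)
Lemma lacunary_exponents (e : R) (m0 M : nat) : 0 < e ->
  exists ms : seq nat, [/\ size ms = M, all (leq m0) ms &
  forall w, cn w ^+ 2 + cn (1 - w) ^+ 2 <= 1 ->
    \sum_(m <- ms) (cn (w ^+ m) + cn (1 - w ^+ m)) <= M%:R * (1 + 2 * e) + 2].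
Proof.
move=> e0.
have hi w m : cn w <= 1 -> cn (1 - w ^+ m) <= e ->
    cn (w ^+ m) + cn (1 - w ^+ m) <= 1 + 2 * e.
  move=> w1 h; have : cn (w ^+ m) <= 1 by rewrite Rcomplex_normX exprn_ile1.
  by lra.
have lo w m : cn (w ^+ m) <= e -> cn (w ^+ m) + cn (1 - w ^+ m) <= 1 + 2 * e.
  move=> h; have := ler_normB (1 : Rcomplex R) (w ^+ m); rewrite Rcomplex_norm1.
  by lra.
have tr w m : cn w <= 1 -> cn (w ^+ m) + cn (1 - w ^+ m) <= 3.
  move=> w1; have : cn (w ^+ m) <= 1 by rewrite Rcomplex_normX exprn_ile1.
  have := ler_normB (1 : Rcomplex R) (w ^+ m); rewrite Rcomplex_norm1; lra.
elim: M => [|M [ms [szms ms0 msP]]].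
  by exists [::]; split=> // w _; rewrite big_nil mul0r add0r.
(* Within [d] of 1 all the earlier powers are [e]-close to 1, since [|1 - w^m| <= m |1 - w|]; the
   successor makes the denominator positive when [ms] is empty. *)
pose d := e / (\sum_(m <- ms) m).+1%:R.
have d0 : 0 < d by rewrite divr_gt0.
have [m1 m1P] := exp_small_away_one d0 e0.
exists (maxn m0 m1 :: ms); split=> [|| w h]; first by rewrite /= szms.
  by rewrite /= leq_maxl.
rewrite big_cons -natr1; have w1 := norm_le1_of_sqr h.
(* Away from 1 the new power is small and the induction hypothesis covers the others; near 1 only
   the new power can be the exceptional one. *)
have [dw|dw] := leP d (cn (1 - w)).
  have := msP w h; have := lo _ _ (m1P _ _ (leq_maxr m0 m1) h dw); lra.
have : \sum_(m <- ms) (cn (w ^+ m) + cn (1 - w ^+ m)) <= M%:R * (1 + 2 * e).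
  have -> : M%:R * (1 + 2 * e) = \sum_(m <- ms) (1 + 2 * e).
    by rewrite big_const_seq count_predT szms iter_addr_0 mulr_natl.
  rewrite big_seq [leRHS]big_seq; apply: ler_sum => m mms; apply: hi => //.
  rewrite (le_trans (norm_one_sub_exp _ w1))//.
  have mS : m%:R <= (\sum_(m <- ms) m).+1%:R :> R.
    by rewrite ler_nat ltnW// ltnS (big_rem m)//= leq_addr.
  rewrite (le_trans (ler_wpM2r _ mS))//.
  by rewrite mulrC -ler_pdivlMr// ltW.
have := tr _ (maxn m0 m1) w1; lra.
Qed.

End ComplexPowers.

(** * Peaking functions with values near the segment [0, 1] *)

Section PeakSets.
Variables (R : realType) (K : topologicalType) (cK : compact [set: K]).
Variables (A : set (contspace R cK)) (uA : uniform_algebra A).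
Local Notation CK := (contspace R cK).
Local Notation cn z := (`|(z : Rcomplex R)|).
Implicit Types f g u : CK.

Lemma contspace_expE f m x : (f ^+ m) x = f x ^+ m.
Proof. by elim: m => [|m IH]; rewrite ?expr0// !exprS -IH. Qed.

Lemma contspace_sumE (I : Type) (r : seq I) (F : I -> CK) x :
  (\sum_(i <- r) F i) x = \sum_(i <- r) F i x.
Proof. by apply: (big_morph (fun f : CK => f x)). Qed.

Lemma unif_scale (a : R) f : A f -> A (a *: f).
Proof.
move=> Af; have [h0 h] := unif_submod uA.
have := h a f 0; rewrite addr0 !inE; apply => //.
by move: h0; rewrite inE.
Qed.

Lemma unif_one : A 1.
Proof.
rewrite (_ : 1 = contcst cK 1); first exact: (unif_cst uA).
exact/val_inj.
Qed.

Lemma unif_exp f m : A f -> A (f ^+ m).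
Proof.
move=> Af; elim: m => [|m IH]; first by rewrite expr0; exact: unif_one.
by rewrite exprS; apply: (unif_mul uA).
Qed.

Lemma unif_sum (I : Type) (r : seq I) (F : I -> CK) :
  (forall i, A (F i)) -> A (\sum_(i <- r) F i).
Proof.
move=> AF; elim/big_ind: _ => //; last exact: (unif_add uA).
by rewrite -(scale0r (1 : CK)); apply: unif_scale; exact: unif_one.
Qed.

(* The function is an average of powers of [(1 + f) / 2] with lacunary
   exponents. *)
Lemma thin_peak_function f (e d : R) : A f -> (forall x, cn (f x) <= 1) ->
  0 < e -> 0 < d -> exists u, [/\ A u, forall x, f x = 1 -> u x = 1,
    forall x, cn (u x) + cn (1 - u x) <= 1 + 4 * e &
    forall x, d <= cn (1 - f x) -> cn (u x) <= e].
Proof.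
move=> Af f1 e0 d0; pose w : CK := 2^-1 *: (1 + f).
have Aw : A w by apply: unif_scale; apply: (unif_add uA) => //; exact: unif_one.
have wE x : w x = 2^-1 *: (1 + f x) by [].
have wP x : cn (w x) ^+ 2 + cn (1 - w x) ^+ 2 <= 1.
  by rewrite wE; apply: half_one_add_bound; exact: f1.
have d20 : 0 < 2^-1 * d by rewrite mulr_gt0 ?invr_gt0.
have [m0 m0P] := exp_small_away_one d20 e0.
(* Averaging over [M >= 1 / e] powers turns the additive 2 of the lacunary bound into at most [2 e],
   whence [1 + 4 e]. *)
pose M := (Num.trunc e^-1).+1.
have M0 : 0 < M%:R :> R by rewrite ltr0n.
have eM : 1 <= e * M%:R.
  by rewrite mulrC -ler_pdivrMr// mul1r ltW// -truncn_lt_nat// invr_ge0 ltW.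
have [ms [szms ms0 msP]] := lacunary_exponents m0 M e0.
have constM (V : lmodType R) (v : V) : v = M%:R^-1 *: \sum_(m <- ms) v.
  rewrite big_const_seq count_predT szms iter_addr_0 -(scaler_nat _ v) scalerA.
  by rewrite mulVf ?scale1r// gt_eqF.
pose u : CK := M%:R^-1 *: \sum_(m <- ms) w ^+ m.
have uE x : u x = M%:R^-1 *: \sum_(m <- ms) w x ^+ m.
  transitivity (M%:R^-1 *: (\sum_(m <- ms) w ^+ m : CK) x) => //.
  rewrite contspace_sumE; congr (_ *: _).
  by apply: eq_bigr => m _; rewrite contspace_expE.
have le_avg (F : nat -> Rcomplex R) :
    cn (M%:R^-1 *: \sum_(m <- ms) F m) <= M%:R^-1 * \sum_(m <- ms) cn (F m).
  rewrite normrZ normfV normr_nat ler_wpM2l ?invr_ge0 ?ler0n//.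
  exact: ler_norm_sum.
exists u; split=> [| x fx | x | x dx].
- by apply: unif_scale; apply: unif_sum => m; exact: unif_exp.
- rewrite uE wE fx [RHS]constM; congr (_ *: _); apply: eq_bigr => m _.
  have -> : 2^-1 *: (1 + 1 : Rcomplex R) = 1; last by rewrite expr1n.
  by apply/eqP; rewrite eq_complex /=; apply/andP; split; apply/eqP; lra.
- have -> : 1 - u x = M%:R^-1 *: \sum_(m <- ms) (1 - w x ^+ m).
    by rewrite uE [X in X - _]constM -scalerBr -sumrB.
  rewrite uE (le_trans (lerD (le_avg _) (le_avg _)))//.
  rewrite -mulrDr -big_split ler_pdivrMl//= (le_trans (msP _ (wP x)))//.
  by nra.
- rewrite uE (le_trans (le_avg _))//.
  rewrite [leRHS](constM R^o) /GRing.scale /= ler_wpM2l ?invr_ge0 ?ler0n//.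
  rewrite big_seq [leRHS]big_seq; apply: ler_sum => m mms.
  apply: (m0P _ (w x)) => //.
    exact: (allP ms0).
  by rewrite wE norm_one_sub_half ler_wpM2l// invr_ge0.
Qed.

End PeakSets.

(** Among finite families in [V], take one whose image under [T] has maximal rank, which is at most
    [n]. Appending [v] cannot raise the rank, so [T v] is a combination of the images, and
    injectivity lifts this relation to [V]. *)
Lemma finite_dimensional_of_injective (R : realType) (V : normedModType R)
    (n : nat) (T : {linear V -> 'rV[R]_n}) :
  (forall v, T v = 0 -> v = 0) -> finite_dimensional V.
Proof.
move=> T0; pose tmx m (b : 'I_m -> V) := \matrix_i T (b i).
pose P (r : nat) := `[< exists m (b : 'I_m -> V), \rank (tmx m b) = r >].
have exP : exists r, P r.
  by exists (\rank (tmx 0%N (fun=> 0))); apply/asboolP; exists 0%N, (fun=> 0).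
have leP r : P r -> (r <= n)%N.
  by move=> /asboolP[m [b <-]]; exact: rank_leq_col.
case: (ex_maxnP exP leP) => r /asboolP[m [b br]] rmax.
exists m, b => v.
pose b' (j : 'I_(m + 1)) : V := if fintype.split j is inl i then b i else v.
have b'E : tmx (m + 1)%N b' = col_mx (tmx m b) (T v).
  apply/matrixP => i j; rewrite !mxE /b'.
  by case: (fintype.split i) => k; rewrite ?mxE// (ord1 k).
have sub : (tmx m b <= col_mx (tmx m b) (T v))%MS.
  by rewrite -addsmxE addsmxSl.
have : (col_mx (tmx m b) (T v) <= tmx m b)%MS.
  rewrite -(geq_leqif (mxrank_leqif_sup sub)) br.
  by apply: rmax; apply/asboolP; exists (m + 1)%N, b'; rewrite b'E.
rewrite -addsmxE addsmx_sub => /andP[_ /submxP[D TvE]].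
exists (fun i => D 0 i); apply/eqP; rewrite -subr_eq0; apply/eqP/T0.
rewrite linearB linear_sum TvE mulmx_sum_row; apply/eqP; rewrite subr_eq0.
by apply/eqP; apply: eq_bigr => i _; rewrite linearZ/= rowK.
Qed.

(** 1 is an extreme point of the closed unit disc. Hence the average of two peaking functions equals
    1 only where both do, and peak sets are stable under nonempty intersection. *)
Lemma Rcomplex_midpoint1 (R : realType) (z w : Rcomplex R) :
  `|z| <= 1 -> `|w| <= 1 -> 2^-1 *: (z + w) = 1 -> z = 1.
Proof.
move=> z1 w1; have : `|z| ^+ 2 <= 1 by rewrite expr_le1.
have : `|w| ^+ 2 <= 1 by rewrite expr_le1.
case: z w {z1 w1} => [a b] [c d]; rewrite !Rcomplex_sqnorm /= => h1 h2.
move/eqP; rewrite eq_complex /= => /andP[/eqP hac /eqP hbd].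
have a1 : a = 1 by nra.
by move: h2; rewrite a1 => h2; congr (_ +i* _)%C; nra.
Qed.

(** * Peak sets and disjoint families of them *)

Section DisjointPeakSets.
Variables (R : realType) (K : topologicalType) (cK : compact [set: K]).
Variables (A : set (contspace R cK)) (uA : uniform_algebra A).
Local Notation CK := (contspace R cK).
Local Notation cn z := (`|(z : Rcomplex R)|).
Implicit Types (f g : CK) (P Q : set K).

(** Modulus 1 may also be attained off [P]; replacing [f] by [(1 + f) / 2] yields a peak function in
    the usual sense, of modulus less than 1 off [P]. *)
Definition peak_set P : Prop := P !=set0 /\
  exists f, [/\ A f, forall x, cn (f x) <= 1 & P = [set x | f x = 1]].

Lemma peak_setI P Q : peak_set P -> peak_set Q -> P `&` Q !=set0 ->
  peak_set (P `&` Q).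
Proof.
move=> [_ [f [Af f1 ->]]] [_ [g [Ag g1 ->]]] PQ; split=> //.
pose h : CK := 2^-1 *: (f + g); exists h.
have hE x : h x = 2^-1 *: (f x + g x) by [].
split=> [|x|].
- by apply: (unif_scale uA); exact: (unif_add uA).
- rewrite hE normrZ gtr0_norm ?invr_gt0// ler_pdivrMl// mulr1.
  by rewrite (le_trans (ler_normD _ _))// lerD.
- apply/seteqP; split=> [x [fx gx]|x].
    change (h x = 1); rewrite hE fx gx.
    by apply/eqP; rewrite eq_complex /=; apply/andP; split; apply/eqP; lra.
  change (h x = 1 -> (f x = 1 /\ g x = 1)); rewrite hE => hx.
  split; first exact: Rcomplex_midpoint1 hx.
  by rewrite addrC in hx; exact: Rcomplex_midpoint1 hx.
Qed.

Lemma peak_set_max_norm f (c : Rcomplex R) x : A f -> f x = c -> c != 0 ->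
  (forall y, cn (f y) <= cn c) -> peak_set [set y | f y = c].
Proof.
move=> Af fx c0 fc; split; first by exists x.
pose g : CK := contcst cK c^-1 * f; exists g.
have hE y : g y = c^-1 * f y :> Rcomplex R by [].
split=> [|y|].
- by apply: (unif_mul uA) => //; exact: (unif_cst uA).
- by rewrite hE Rcomplex_normM Rcomplex_normV ler_pdivrMl ?normr_gt0// mulr1.
- apply/seteqP; split=> y.
    by move=> fy; change (g y = 1); rewrite hE fy mulVf.
  change (g y = 1 -> f y = c); rewrite hE => h.
  by rewrite -[f y]mul1r -(mulfV c0) -mulrA h mulr1.
Qed.

Lemma peak_set_closed P : peak_set P -> closed P.
Proof.
move=> [_ [f [_ _ ->]]].
apply: (@closed_comp _ _ f [set 1]) => [x _|].
  exact: contspace_continuous.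
apply: accessible_closed_set1; apply: hausdorff_accessible.
exact: norm_hausdorff.
Qed.

(** The peak subsets of [E] are stable under intersection, so they generate a proper filter. By
    compactness it has a cluster point, which lies in each of them because they are closed. *)
Lemma common_peak_point (E : set K) : peak_set E ->
  (forall P Q, peak_set P -> peak_set Q -> P `<=` E -> Q `<=` E ->
    P `&` Q !=set0) ->
  exists x, forall P, peak_set P -> P `<=` E -> P x.
Proof.
move=> pE meet.
pose F : set_system K :=
  [set B | exists P, [/\ peak_set P, P `<=` E & P `<=` B]].
have FF : ProperFilter F.
  split; first by move=> [P [[[x Px] _] _ /(_ x Px)]].
  split; first by exists E; split.
    move=> B C [P [pP PE PB]] [Q [pQ QE QC]].
    exists (P `&` Q); split; first by apply: peak_setI => //; exact: meet.
      by move=> x [/PE].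
    by move=> x [/PB ? /QC].
  by move=> B C BC [P [pP PE PB]]; exists P; split=> //; exact: subset_trans BC.
have [x [_ xF]] := cK FF filterT.
exists x => P pP PE; apply: (peak_set_closed pP) => B xB.
by apply: xF => //; exists P; split.
Qed.

Lemma max_norm_attained f : f <> 0 ->
  exists2 x, f x != 0 & forall y, cn (f y) <= cn (f x).
Proof.
move=> f0; have [y fy] : exists y, f y != 0.
  apply: contrapT => h; apply: f0; apply/val_inj/funext => y.
  by apply/eqP/negPn/negP => fy; apply: h; exists y.
have K0 : [set: K] !=set0 by exists y.
have fc : {within [set: K], continuous (fun x => cn (f x))}.
  apply: continuous_subspaceT => x.
  by apply: cvg_norm; exact: contspace_continuous.
have [x _ xmax] := compact_EVT_max K0 cK fc.
have xm z : cn (f z) <= cn (f x) by apply: xmax; rewrite inE.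
by exists x => //; rewrite -normr_gt0 (lt_le_trans _ (xm y))// normr_gt0.
Qed.

(** The real and imaginary parts of the values at the [n] points form an injective real-linear map
    into a space of dimension [n + n]. *)
Lemma finite_dimensional_of_points n (x : 'I_n -> K) :
  (forall f, A f -> (forall i, f (x i) = 0) -> f = 0) ->
  finite_dimensional (unif_space uA).
Proof.
move=> x0.
pose T (f : unif_space uA) : 'rV[R]_(n + n) :=
  row_mx (\row_i complex.Re (f (x i))) (\row_i complex.Im (f (x i))).
have Tlin : linear T.
  move=> a f g; rewrite /T scale_row_mx add_row_mx.
  have fgE i : (a *: f + g) (x i) = a *: f (x i) + g (x i) by [].
  by congr row_mx; apply/matrixP => k i; rewrite !mxE fgE;
    case: (f (x i)) (g (x i)) => u v [s t].
pose TT : {linear unif_space uA -> 'rV[R]_(n + n)} :=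
  HB.pack T (GRing.isLinear.Build R _ _ _ T Tlin).
apply: (@finite_dimensional_of_injective _ _ _ TT) => f.
rewrite /= -[0]row_mx0 => /eq_row_mx[/matrixP re /matrixP im].
apply/val_inj/x0 => [|i]; first by have := unif_valP f; rewrite !inE.
apply/eqP; rewrite eq_complex; have := re 0 i; have := im 0 i.
by rewrite !mxE => -> ->; rewrite !eqxx.
Qed.

(** Indexing by [nat] lets a family be enlarged without changing the index type; members from [n] on
    are arbitrary. *)
Definition disjoint_peaks (n : nat) (E : nat -> set K) : Prop :=
  (forall i, (i < n)%N -> peak_set (E i)) /\
  forall i j, (i < n)%N -> (j < n)%N -> i <> j -> ~ (E i `&` E j !=set0).

Lemma disjoint_peaksS n (E : nat -> set K) P :
  disjoint_peaks n E -> peak_set P ->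
  (forall i, (i < n)%N -> ~ (E i `&` P !=set0)) ->
  disjoint_peaks n.+1 (fun i => if (i < n)%N then E i else P).
Proof.
move=> [pE dE] pP EP; split=> [i _|i j]; first by case: ifPn => // /pE.
rewrite !ltnS => ilen jlen ij; case: ltnP => ni; case: ltnP => nj.
- exact: dE.
- exact: EP.
- by rewrite setIC; exact: EP.
- exfalso; apply: ij; apply/eqP.
  by rewrite eqn_leq (leq_trans ilen nj) (leq_trans jlen ni).
Qed.

(* If a disjoint family of peak sets cannot be enlarged, then two peak subsets
   of the same member always meet, so all of them share a point; these points
   determine every function of the algebra, because the set where a function
   takes a value of maximal modulus is, up to scaling, a peak set. *)
Lemma disjoint_peaks_exist : ~ finite_dimensional (unif_space uA) ->
  forall n, exists E, disjoint_peaks n E.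
Proof.
move=> infdim; elim=> [|n [E dE]]; first by exists (fun=> set0); split.
apply: contrapT => noE; apply: infdim.
have [pE ddE] := dE.
have meetE P : peak_set P -> exists i : 'I_n, E i `&` P !=set0.
  move=> pP; apply: contrapT => h; apply: noE.
  exists (fun i => if (i < n)%N then E i else P); apply: disjoint_peaksS => //.
  by move=> i ni EP; apply: h; exists (Ordinal ni).
(* Otherwise replacing [E i] by [P] and adding [Q] would give [n + 1] disjoint peak sets. *)
have meet (i : 'I_n) P Q : peak_set P -> peak_set Q -> P `<=` E i ->
    Q `<=` E i -> P `&` Q !=set0.
  move=> pP pQ PE QE; apply: contrapT => PQ; apply: noE.
  pose E' j := if j == i :> nat then P else E j.
  have E'E j : E' j `<=` E j.
    by rewrite /E'; case: eqP => [->//|_]; exact: subset_refl.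
  exists (fun j => if (j < n)%N then E' j else Q); apply: disjoint_peaksS => //.
    split=> [j jn|j k jn kn jk [y [/E'E jy /E'E ky]]].
      by rewrite /E'; case: eqP => // _; exact: pE.
    by apply: (ddE j k) => //; exists y.
  move=> j jn; rewrite /E'; case: eqP => // ji [y [Ey /QE Qy]].
  by apply: (ddE j i) => //; exists y.
have /choice[x xP] (i : 'I_n) : exists x, forall P, peak_set P ->
    P `<=` E i -> P x.
  by apply: common_peak_point => [|P Q]; [exact: pE|exact: meet].
apply: (finite_dimensional_of_points (x := x)) => f Af fx0.
apply: contrapT => /max_norm_attained[y fy ymax].
(* This peak set meets some [E i] in a peak subset of [E i], which contains [x i]; hence
   [f (x i) = f y], which is nonzero. *)
have pP := peak_set_max_norm Af erefl fy ymax.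
have [i EP] := meetE _ pP.
have [_ /= fxi] := xP i _ (peak_setI (pE i (ltn_ord i)) pP EP) (@subIsetl _ _ _).
by move: fy; rewrite -fxi fx0 eqxx.
Qed.

End DisjointPeakSets.

(** * Almost disjoint functions and functionals on them *)

Section AlmostDisjoint.
Variables (R : realType) (K : topologicalType) (cK : compact [set: K]).
Variables (A : set (contspace R cK)) (uA : uniform_algebra A).
Local Notation CK := (contspace R cK).
Local Notation X := (unif_space uA).
Local Notation cn z := (`|(z : Rcomplex R)|).

(** On a nonempty compact space the continuous positive function [|1 - f| + |1 - g|] has a positive
    minimum, and half of it serves as [d]. *)
Lemma disjoint_level_gap (f g : CK) :
  (forall x, f x = 1 -> g x <> 1) ->
  exists2 d : R, 0 < d & forall x, d <= cn (1 - f x) \/ d <= cn (1 - g x).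
Proof.
move=> fg; have [K0|K0] := pselect ([set: K] !=set0); last first.
  by exists 1 => // x; exfalso; apply: K0; exists x.
have cnt : {within [set: K], continuous (fun x => cn (1 - f x) + cn (1 - g x))}.
  apply: continuous_subspaceT => x; apply: cvgD; apply: cvg_norm; apply: cvgB;
    by [exact: cvg_cst|exact: contspace_continuous].
have [x _ xmin] := compact_EVT_min K0 cK cnt.
set m := cn (1 - f x) + cn (1 - g x) in xmin.
have m0 : 0 < m.
  rewrite lt_neqAle eq_sym addr_ge0// andbT paddr_eq0// !normr_eq0 !subr_eq0.
  by apply/negP => /andP[/eqP fx /eqP gx]; exact: (fg x).
exists (m / 2); first by rewrite divr_gt0.
move=> y; have : m <= cn (1 - f y) + cn (1 - g y) by apply: xmin; rewrite inE.
case: (leP (m / 2) (cn (1 - f y))) => [|h1 h2]; first by left.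
by right; lra.
Qed.

(** For functions [f k] peaking on disjoint sets, some [d] works for all pairs: at each point at
    most one [f k] is within [d] of 1. The thin functions built from the other [f k] are small
    there. *)
Lemma almost_disjoint_functions (N : nat) (e : R) :
  ~ finite_dimensional X -> 0 < e ->
  exists u : 'I_N -> X, [/\ forall k, exists x, u k x = 1,
    forall k x, cn (u k x) + cn (1 - u k x) <= 1 + e &
    forall x, \sum_k cn (u k x) <= 1 + e].
Proof.
move=> infdim e0; have [E [pE dE]] := disjoint_peaks_exist infdim N.
have /choice[f fP] (k : 'I_N) : exists f : CK,
    [/\ A f, forall x, cn (f x) <= 1 & E k = [set x | f x = 1]].
  by have [_ [f ?]] := pE k (ltn_ord k); exists f.
pose gap (k l : 'I_N) (d : R) :=
  k != l -> forall x, d <= cn (1 - f k x) \/ d <= cn (1 - f l x).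
have gapP k l : \forall d \near (0 : R)^'+, gap k l d.
  have [->|kl] := eqVneq k l; first by apply: nearW => d; rewrite /gap eqxx.
  have [|d d0 dP] := @disjoint_level_gap (f k) (f l).
    move=> x fk fl; apply: (dE k l) => //; first by move/val_inj/eqP; exact/negP.
    by have [_ _ ->] := fP k; have [_ _ ->] := fP l; exists x.
  near=> d' => _ x; have dd : d' <= d by near: d'; exact: nbhs_right_le.
  by have [h|h] := dP x; [left|right]; exact: le_trans h.
have gapP' k : \forall d \near (0 : R)^'+, forall l, gap k l d.
  exact: filter_forall (gapP k).
have [d [d0 dP]] :=
  filter_ex (filterI (nbhs_right_gt (0 : R)) (filter_forall _ gapP')).
(* At each point the small terms sum to at most [N e'] and the exceptional one is at most
   [1 + 4 e']. *)
pose e' := e / (N%:R + 4).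
have N4 : 0 < N%:R + 4 :> R by rewrite ltr_wpDl.
have e'0 : 0 < e' by rewrite divr_gt0.
have e'E : e = N%:R * e' + 4 * e' by rewrite -mulrDl mulrC divfK// gt_eqF.
have Ne' : 0 <= N%:R * e' by rewrite mulr_ge0// ltW.
have /choice[u uP] (k : 'I_N) : exists u : X,
    [/\ forall x, f k x = 1 -> u x = 1,
      forall x, cn (u x) + cn (1 - u x) <= 1 + 4 * e' &
      forall x, d <= cn (1 - f k x) -> cn (u x) <= e'].
  have [Af f1 _] := fP k.
  have [u [Au ? ? ?]] := thin_peak_function uA Af f1 e'0 d0.
  have Au' : u \in unif_pred uA by rewrite !inE.
  by exists (UnifSpace Au').
exists u; split=> [k|k x|x].
- have [uk _ _] := uP k; have [[x Ex] _] := pE k (ltn_ord k).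
  by exists x; apply: uk; have [_ _ EE] := fP k; rewrite EE in Ex.
- by have [_ uk _] := uP k; rewrite (le_trans (uk x))// lerD2l e'E lerDr.
- have small k : d <= cn (1 - f k x) -> cn (u k x) <= e'.
    by have [_ _ uk] := uP k; exact: uk.
  have sumE (P : pred 'I_N) : (forall k, P k -> cn (u k x) <= e') ->
      \sum_(k | P k) cn (u k x) <= N%:R * e'.
    move=> Pe; apply: (@le_trans _ _ (\sum_(k < N) e')).
      rewrite big_mkcond; apply: ler_sum => k _.
      by case: ifPn => [/Pe//|_]; exact: ltW.
    by rewrite sumr_const card_ord mulr_natl.
  have [[k0 k0P]|nk] := pselect (exists k, cn (1 - f k x) < d); last first.
    have : \sum_k cn (u k x) <= N%:R * e'.
      by apply: sumE => k _; apply: small; rewrite leNgt; apply/negP => ?;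
        apply: nk; exists k.
    by move: e'E; lra.
  rewrite (bigD1 k0)//=.
  have : \sum_(k | k != k0) cn (u k x) <= N%:R * e'.
    apply: sumE => k kk0; apply: small.
    by have [//|] := dP _ _ kk0 x; rewrite leNgt k0P.
  have [_ uk _] := uP k0; have := uk x; have := normr_ge0 (1 - u k0 x : Rcomplex R).
  by move: e'E; lra.
Unshelve. all: by end_near. Qed.

Definition unif_prod (f g : X) : X :=
  UnifSpace (mem_set
    (unif_mul uA (set_mem (unif_valP f)) (set_mem (unif_valP g)))).

Definition unif_const (z : Rcomplex R) : X :=
  UnifSpace (mem_set (unif_cst uA z)).

Lemma unif_norm_le (f : X) (c : R) :
  0 <= c -> (forall x, cn (f x) <= c) -> `|f| <= c.
Proof. by move=> c0 fc; apply: supnorm_le. Qed.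

Lemma le_unif_norm (f : X) x : cn (f x) <= `|f|.
Proof. exact: le_supnorm. Qed.

Lemma unif_sumE (n : nat) (a : 'I_n -> R) (h : 'I_n -> X) x :
  (\sum_i a i *: h i : X) x = \sum_i a i *: (h i x).
Proof. by apply: (big_morph (fun f : X => f x)). Qed.

(** With suitable signs the sum becomes the value of [phi] at one signed sum of the [v k], whose
    norm is at most [C] by the pointwise bound. *)
Lemma sum_functional_le (phi : {linear X -> R}) (N : nat) (v : 'I_N -> X)
    (C : R) : (forall f, `|phi f| <= `|f|) -> 0 <= C ->
  (forall x, \sum_k cn (v k x) <= C) -> \sum_k `|phi (v k)| <= C.
Proof.
move=> phi1 C0 vC.
have -> : \sum_k `|phi (v k)| = phi (\sum_k Num.sg (phi (v k)) *: v k).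
  by rewrite linear_sum; apply: eq_bigr => k _; rewrite linearZ/= normrEsg.
rewrite (le_trans (ler_norm _))// (le_trans (phi1 _))//.
apply: unif_norm_le => // x; rewrite unif_sumE.
rewrite (le_trans (ler_norm_sum _ _ _))// (le_trans _ (vC x))//.
apply: ler_sum => k _; rewrite normrZ ler_piMl// normr_sg.
by case: (_ != _).
Qed.

End AlmostDisjoint.

(** * Slices and the upper bound 2 for the diameter *)

Section DualSphere.
Variables (R : realType) (X : normedModType R).

Lemma dual_sphere_le (phi : {linear X -> R}) x :
  dual_sphere phi -> `|phi x| <= `|x|.
Proof.
move=> [_ phi1]; have [->|x0] := eqVneq x 0; first by rewrite linear0 !normr0.
have nx : 0 < `|x| by rewrite normr_gt0.
have : ((`|phi (`|x|^-1 *: x)|)%:E <= dual_norm phi)%E.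
  apply: ereal_sup_ubound; exists (`|x|^-1 *: x) => //=.
  by rewrite /unit_ball /= normrZ normfV normr_id mulVf// gt_eqF.
rewrite phi1 lee_fin linearZ/= normrM normfV normr_id.
by rewrite ler_pdivrMl// mulr1.
Qed.

Lemma slice_nonempty (phi : {linear X -> R}) (e : R) :
  dual_sphere phi -> 0 < e -> slice phi e !=set0.
Proof.
move=> [_ phi1] e0.
have : ((1 - e)%:E < dual_norm phi)%E by rewrite phi1 lte_fin ltrBlDr ltrDl.
move=> /ereal_sup_gt[_ [x x1 <-]]; rewrite lte_fin => ex.
(* The dual norm only makes [|phi x|] large, so [x] may have to be replaced by [- x]. *)
have [phix|phix] := leP 0 (phi x).
  by exists x; split=> //; rewrite -(ger0_norm phix).
exists (- x); split; first by move: x1; rewrite /unit_ball /= normrN.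
by rewrite linearN -(ltr0_norm phix).
Qed.

Lemma diameter_convex_comb_slices_le (n : nat) (lam eps : 'I_n -> R)
    (f : 'I_n -> {linear X -> R}) :
  (forall i, 0 <= lam i) -> \sum_i lam i = 1 ->
  (diameter (convex_comb lam (fun i => slice (f i) (eps i))) <= 2%:E)%E.
Proof.
move=> lam0 lam1.
have ball x : convex_comb lam (fun i => slice (f i) (eps i)) x -> `|x| <= 1.
  move=> [h hS ->]; rewrite (le_trans (ler_norm_sum _ _ _))// -lam1.
  apply: ler_sum => i _; rewrite normrZ ger0_norm// ler_piMr//.
  by have [] := hS i.
apply: ge_ereal_sup => _ [x /ball x1 [y /ball y1 <-]].
rewrite lee_fin (le_trans (ler_normB _ _))//.
by rewrite [leRHS](_ : 2 = 1 + 1)// lerD.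
Qed.

End DualSphere.

(** * The lower bound for the diameter *)

Theorem theorem4p2 (R : realType) (K : topologicalType)
    (cK : compact [set: K]) (hK : hausdorff_space K)
    (A : set (contspace R cK)) (uA : uniform_algebra A) :
  ~ finite_dimensional (unif_space uA) ->
  strong_diameter2 (unif_space uA).
Proof.
move=> infdim n lam eps f n0 lam0 lam1 fS eps0.
apply/eqP; rewrite eq_le diameter_convex_comb_slices_le//=.
apply/lee_addgt0Pr => r r0.
have /choice[g gS] i : exists g, slice (f i) (eps i) g.
  exact: slice_nonempty.
(* One [e] pays for the value of [f i] on the perturbation, the other for the division by
   [1 + e]. *)
have gap i : \forall e \near (0 : R)^'+, 2 * e < f i (g i) - (1 - eps i).
  have [_ gi] := gS i.
  near=> e; suff : e < (f i (g i) - (1 - eps i)) / 2 by lra.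
  by near: e; apply: nbhs_right_lt; rewrite divr_gt0// subr_gt0.
(* From [e <= r / 2] follows [2 - r <= 2 / (1 + e)]. *)
have r20 : 0 < r / 2 by rewrite divr_gt0.
have [e [[e0 er] egap]] := filter_ex (filterI (filterI
  (nbhs_right_gt (0 : R)) (nbhs_right_le r20)) (filter_forall _ gap)).
rewrite /= in e0 er egap.
have e1 : 0 < 1 + e by rewrite addr_gt0.
pose N := (Num.trunc (n%:R * (4 * (1 + e)) / e)).+1.
have Ne : n%:R * (4 * (1 + e)) < N%:R * e.
  by rewrite -ltr_pdivrMr// -truncn_lt_nat// !mulr_ge0// ?invr_ge0 ltW.
have [u [u1 uthin usum]] := almost_disjoint_functions N infdim e0.
pose t i (s : bool) := unif_const uA ((-1) ^+ s) - g i.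
have tE i s x : t i s x = (-1) ^+ s - g i x by [].
have prodE (p q : unif_space uA) x : unif_prod p q x = p x * q x by [].
have g1 i x : `|g i x : Rcomplex R| <= 1.
  by rewrite (le_trans (le_unif_norm _ _))//; have [] := gS i.
have sgn1 (s : bool) : `|(-1) ^+ s : Rcomplex R| = 1.
  by case: s; rewrite ?expr0 ?expr1 ?normrN Rcomplex_norm1.
pose a i s k := `|f i (unif_prod (t i s) (u k))|.
(* Otherwise each of the [N] indices [k] contributes more than [e] for some pair [(i, s)], whereas
   each of the [2 n] pairs has total at most [2 (1 + e)] over [k]; [N] was chosen to exclude
   this. *)
have [k kP] : exists k, forall i s, a i s k <= e.
  apply: contrapT => h.
  have big k : e <= \sum_i (a i false k + a i true k).
    have : exists i s, e < a i s k.
      apply: contrapT => h'; apply: h; exists k => i s; rewrite leNgt.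
      by apply/negP => ?; apply: h'; exists i, s.
    move=> [i [s /ltW eia]]; rewrite (le_trans eia)// (bigD1 i)//=.
    apply: ler_wpDr; first by apply: sumr_ge0 => j _; rewrite /a addr_ge0.
    by case: s {eia}; rewrite ?lerDl ?lerDr /a.
  have aC i s : \sum_k a i s k <= 2 * (1 + e).
    apply: sum_functional_le => [v||x]; first exact: dual_sphere_le.
      by rewrite mulr_ge0// ltW.
    apply: (@le_trans _ _ (\sum_k 2 * `|u k x : Rcomplex R|)); last first.
      by rewrite -mulr_sumr ler_wpM2l.
    apply: ler_sum => j _; rewrite prodE Rcomplex_normM ler_wpM2r//.
    rewrite tE (le_trans (ler_normB _ _))// sgn1.
    by have := g1 i x; lra.
  have : N%:R * e <= n%:R * (4 * (1 + e)).
    apply: (@le_trans _ _ (\sum_k \sum_i (a i false k + a i true k))).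
      rewrite -[N in N%:R]card_ord mulr_natl -sumr_const.
      exact: ler_sum.
    rewrite exchange_big -[n in leRHS]card_ord mulr_natl -sumr_const.
    apply: ler_sum => i _; rewrite big_split /=.
    by have := aC i false; have := aC i true; lra.
  by rewrite leNgt Ne.
pose h s i := (1 + e)^-1 *: (g i + unif_prod (t i s) (u k)).
have hE s i x : h s i x = (1 + e)^-1 *: (g i x + t i s x * u k x) by [].
have hS s i : slice (f i) (eps i) (h s i).
  split.
    apply: unif_norm_le => // x; rewrite hE normrZ gtr0_norm ?invr_gt0//.
    rewrite ler_pdivrMl// mulr1 tE.
    (* In this form the modulus is at most [|1 - u| + |u| <= 1 + e]. *)
    have -> : g i x + ((-1) ^+ s - g i x) * u k x
      = g i x * (1 - u k x) + (-1) ^+ s * u k x :> Rcomplex R.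
      by rewrite mulrBl mulrBr mulr1 addrCA addrC -addrA addrCA addrA.
    rewrite (le_trans (ler_normD _ _))// (le_trans _ (uthin k x))// addrC.
    rewrite lerD//; first by rewrite Rcomplex_normM sgn1 mul1r.
    by rewrite Rcomplex_normM ler_piMl.
  rewrite linearZ linearD/= /GRing.scale /= mulrC ltr_pdivlMr//.
  have := kP i s; rewrite ler_norml => /andP[ki _].
  by have := egap i; have := eps0 i; nra.
have [x ux] := u1 k.
(* Where [u k] is 1 the value of [h s i] does not depend on [i], so every convex combination takes
   it too. *)
have hx s : (\sum_i lam i *: h s i) x = (1 + e)^-1 *: (-1) ^+ s.
  rewrite unif_sumE; transitivity (\sum_i lam i *: ((1 + e)^-1 *: (-1) ^+ s :
    Rcomplex R)); last by rewrite -scaler_suml lam1 scale1r.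
  by apply: eq_bigr => i _; rewrite hE tE ux mulr1 [g i x + _]addrC subrK.
apply: (@le_trans _ _ ((2 - r)%:E + r%:E)%E).
  by rewrite -EFinD subrK.
apply: leeD2r; apply: le_trans (_ : (2 * (1 + e)^-1)%:E <= _)%E.
  by rewrite lee_fin ler_pdivlMr//; nra.
apply: ereal_sup_ge => /=.
exists (`|\sum_i lam i *: h false i - \sum_i lam i *: h true i|)%:E.
  exists (\sum_i lam i *: h false i); first by exists (h false).
  by exists (\sum_i lam i *: h true i) => //; exists (h true).
rewrite lee_fin; apply: le_trans (le_unif_norm _ x).
have -> : (\sum_i lam i *: h false i - \sum_i lam i *: h true i) x
   = (1 + e)^-1 *: (1 + 1) :> Rcomplex R.
  transitivity ((\sum_i lam i *: h false i) x - (\sum_i lam i *: h true i) x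
    : Rcomplex R) => //.
  by rewrite !hx -scalerBr expr0 expr1 opprK.
rewrite normrZ gtr0_norm ?invr_gt0// mulrC ler_wpM2l ?invr_ge0 ?(ltW e1)//.
rewrite -mulr2n -(scaler_nat 2 (1 : Rcomplex R)) normrZ Rcomplex_norm1 mulr1.
exact: ler_norm.
Unshelve. all: by end_near. Qed.
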